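(* Let $b\geq 2$ and $\rho\geq 1$ be integers, let $\Lambda=(\lambda_1,\ldots,\lambda_\rho)$ be an integer sequence with $1\leq\lambda_1\leq\cdots\leq\lambda_\rho$, let $T=(t_{\ell,i})_{1\leq\ell\leq\rho,\,1\leq i\leq\lambda_\ell}$ be a tuple of positive integer parameters, and let $Z=(z_{\ell,i})_{1\leq\ell\leq\rho,\,1\leq i\leq\lambda_\ell}$ be a tuple of variables. (a) For any integer $n\geq 1$ we have $$\Omega_{b,T}^\Lambda(n;Z)=\sum_{h=1}^{C_b^\Lambda(n)}\prod_{\ell=1}^\rho z_{\ell,1}^{p_{h,\ell,1}(t_{\ell,1})}\cdots z_{\ell,\lambda_\ell}^{p_{h,\ell,\lambda_\ell}(t_{\ell,\lambda_\ell})},$$ where for each $h=1,\ldots,C_b^\Lambda(n)$, the exponents $p_{h,\ell,i}(t_{\ell,i})$, $1\leq\ell\leq\rho$ and $1\leq i\leq\lambda_\ell$, are polynomials (in $t_{\ell,i}$) with only $0$ and $1$ as coefficients. (b) Moreover, the indices $h=1,\ldots,C_b^\Lambda(n)$ (that is, the monomials in the sum in (a)) are in one-to-one correspondence with the $\Lambda$-restricted $\rho$-colored $b$-ary partitions of $n$ in the following way. Fix $h$, and for each pair $(\ell,i)$ with $1\leq\ell\leq\rho$ and $1\leq i\leq\lambda_\ell$ write $$p_{h,\ell,i}(t_{\ell,i})=t_{\ell,i}^{\tau_{\ell,i}(1)}+t_{\ell,i}^{\tau_{\ell,i}(2)}+\cdots+t_{\ell,i}^{\tau_{\ell,i}(\mu_{\ell,i})},\qquad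 \mu_{\ell,i}\geq 0,$$ where the exponents $\tau_{\ell,i}(1)<\tau_{\ell,i}(2)<\cdots<\tau_{\ell,i}(\mu_{\ell,i})$ form a strictly increasing finite sequence of nonnegative integers, and where $\mu_{\ell,i}=0$ corresponds to $p_{h,\ell,i}(t_{\ell,i})=0$. Then the $\Lambda$-restricted $\rho$-colored $b$-ary partition of $n$ corresponding to the index-$h$ monomial is $$\sum_{\ell=1}^{\rho}\sum_{i=1}^{\lambda_\ell}\left(i\cdot b_\ell^{\tau_{\ell,i}(1)}+\cdots+i\cdot b_\ell^{\tau_{\ell,i}(\mu_{\ell,i})}\right),$$ where the subscript $\ell$ in $b_\ell$ indicates that the part in question has the $\ell$th color, so that $i\cdot b_\ell^{\tau}$ stands for $i$ copies of the part $b^\tau$ in color $\ell$.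
   Context: A $\Lambda$-restricted $\rho$-colored $b$-ary partition of an integer $n\geq1$ is a multiset of powers $b^j$ ($j\geq 0$), each assigned one of $\rho$ colors, whose sum is $n$, and where for each $j\geq 0$ and each $r$ with $1\leq r\leq\rho$, at most $\lambda_r$ parts $b^j$ are assigned the $r$th color. $C_b^\Lambda(n)$ denotes the number of such partitions of $n$. The polynomials $\Omega_{b,T}^\Lambda(n;Z)$ in the $\lambda_1+\cdots+\lambda_\rho$ variables $z_{\ell,i}$ are defined by the generating function (a formal power series identity in $q$) $$\sum_{n=0}^\infty\Omega_{b,T}^\Lambda(n;Z)q^n=\prod_{j=0}^\infty\prod_{\ell=1}^\rho\left(1+z_{\ell,1}^{t_{\ell,1}^j}q^{b^j}+z_{\ell,2}^{t_{\ell,2}^j}q^{2\cdot b^j}+\cdots+z_{\ell,\lambda_\ell}^{t_{\ell,\lambda_\ell}^j}q^{\lambda_\ell\cdot b^j}\right).$$ The exponents $p_{h,\ell,i}(t_{\ell,i})$ are understood as formal polynomials in $t_{\ell,i}$ (so that their exponents $\tau_{\ell,i}(\cdot)$ are well defined), evaluated at the integer parameters $t_{\ell,i}$. *)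

(* Defs.v *)
From HB Require Import structures.
From mathcomp Require Import all_boot all_order all_algebra finmap multiset.
From mathcomp Require Import boolp classical_sets functions cardinality.
From mathcomp Require Import mpoly.

Set Implicit Arguments.
Unset Strict Implicit.
Unset Printing Implicit Defensive.

Import GRing.Theory.

Local Open Scope ring_scope.

(* The powers b ^ j are stored by value; the second component is the color. *)
Notation colored_parts rho := {mset (nat * 'I_rho)}%mset (only parsing).

Definition is_restricted_partition (b rho : nat) (lam : 'I_rho -> nat)
    (n : nat) (P : colored_parts rho) : Prop :=
  [/\ forall x, x \in P -> exists j : nat, x.1 = (b ^ j)%N,
      (\sum_(x <- P) x.1)%N = n
    & forall (j : nat) (r : 'I_rho), (P ((b ^ j)%N, r) <= lam r)%N].

Definition restricted_partitions (b rho : nat) (lam : 'I_rho -> nat) (n : nat) :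
    set (colored_parts rho) :=
  [set P | is_restricted_partition b lam n P]%classic.

(* [fset_set] is meaningful here because of [finite_restricted_partitions]. *)
Definition num_partitions (b rho : nat) (lam : 'I_rho -> nat) (n : nat) : nat :=
  #|` fset_set (restricted_partitions b lam n)|%fset.

HB.instance Definition _ (K : choiceType) :=
  Monoid.isComLaw.Build (multiset_of (Phant K)) mset0 (@msetD K)
    (@msetDA K) (@msetDC K) (@mset0D K).

(* The index i : 'I_(lam l) is 0-based: it stands for i.+1, here and in the
   variables and parameters below. *)
Definition partition_of_exponents (b rho : nat) (lam : 'I_rho -> nat)
    (tau : forall l : 'I_rho, 'I_(lam l) -> seq nat) : colored_parts rho :=
  \big[@msetD _/mset0]_(l < rho) \big[@msetD _/mset0]_(i < lam l)
    \big[@msetD _/mset0]_(k <- tau l i) msetn i.+1 ((b ^ k)%N, l).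

Definition zindex (rho : nat) (lam : 'I_rho -> nat) : finType :=
  {l : 'I_rho & 'I_(lam l)}.

Definition zpoly (rho : nat) (lam : 'I_rho -> nat) :=
  {mpoly int[#|zindex lam|]}.

Definition zvar (rho : nat) (lam : 'I_rho -> nat) (l : 'I_rho) (i : 'I_(lam l)) :
    zpoly lam :=
  'X_(enum_rank (Tagged (fun l : 'I_rho => 'I_(lam l)) i : zindex lam)).

(* A formal power series over R is given by its coefficients c : nat -> R; it is
   the infinite product of the polynomials F j when the partial products
   converge to it coefficientwise, i.e. in the 'X-adic topology. *)
Definition is_infinite_product (R : comNzRingType) (F : nat -> {poly R})
    (c : nat -> R) : Prop :=
  forall n : nat, exists N0 : nat, forall N : nat, (N0 <= N)%N ->
    (\prod_(j < N) F j)`_n = c n.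

Definition Omega_factor (b rho : nat) (lam : 'I_rho -> nat)
    (t : forall l : 'I_rho, 'I_(lam l) -> nat) (j : nat) : {poly zpoly lam} :=
  \prod_(l < rho)
    (1 + \sum_(i < lam l) (zvar i ^+ (t l i ^ j)%N) *: 'X^(i.+1 * b ^ j)).

(* Such an Omega exists and is unique when 1 < b: see [exists_Omega] and
   [Omega_unique]. *)
Definition is_Omega (b rho : nat) (lam : 'I_rho -> nat)
    (t : forall l : 'I_rho, 'I_(lam l) -> nat) (Omega : nat -> zpoly lam) : Prop :=
  is_infinite_product (Omega_factor b t) Omega.

Lemma finite_restricted_partitions (b rho : nat) (lam : 'I_rho -> nat) (n : nat) :
  (1 < b)%N -> finite_set (restricted_partitions b lam n).
Proof.
move=> b_gt1.
pose D := ('I_n.+1 * 'I_rho)%type.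
pose f (g : {ffun D -> 'I_n.+1}) : colored_parts rho :=
  \big[@msetD _/mset0]_(x : D) msetn (g x) (val x.1, x.2).
apply: (@sub_finite_set _ _ (f @` [set: {ffun D -> 'I_n.+1}])%classic); last first.
  by apply: finite_image; apply: finite_finset.
move=> P [Ppow Psum _].
have Ple x : x \in P -> (P x * x.1 <= n)%N.
  move=> xP; rewrite -Psum sum_mset.
  by rewrite (big_fsetD1 x) /= ?leq_addr// multiset.msuppE.
have Ppos x : x \in P -> (0 < x.1)%N.
  by move=> /Ppow[j ->]; rewrite expn_gt0 ltnW.
have Pval x : x \in P -> (x.1 < n.+1)%N.
  move=> xP; rewrite ltnS (leq_trans _ (Ple x xP))// leq_pmull//.
  by rewrite -in_mset.
have Pmul x : (P x < n.+1)%N.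
  case: (boolP (x \in P)) => [xP|/mset_eq0P->//].
  by rewrite ltnS (leq_trans _ (Ple x xP))// leq_pmulr// Ppos.
exists [ffun x : D => Ordinal (Pmul (val x.1, x.2))] => //.
apply/msetP => -[a r].
have fE (s : seq D) (F : D -> colored_parts rho) y :
    (\big[@msetD _/mset0]_(x <- s) F x) y = (\sum_(x <- s) F x y)%N.
  by elim: s => [|u s IH]; rewrite ?big_nil ?mset0E// !big_cons msetE2 IH.
rewrite /f fE; case: (ltnP a n.+1) => an.
  rewrite (bigD1 (Ordinal an, r)) //= big1 ?addn0.
    by rewrite msetnE eqxx ffunE.
  move=> [c s] ne; rewrite msetnE; case: eqP => // -[ac rs].
  by case/eqP: ne; congr pair => //; apply: val_inj.
rewrite big1 => [|[c s] _].
  apply/esym/mset_eq0P/negP => /Pval /=.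
  by rewrite ltnNge an.
rewrite msetnE; case: eqP => // -[ac _].
by move: an; rewrite ac leqNgt /= ltn_ord.
Qed.

Lemma exists_Omega (b rho : nat) (lam : 'I_rho -> nat)
    (t : forall l : 'I_rho, 'I_(lam l) -> nat) :
  (1 < b)%N -> exists Omega : nat -> zpoly lam, is_Omega b t Omega.
Proof.
move=> b_gt1; exists (fun n => (\prod_(j < n) Omega_factor b t j)`_n) => n.
exists n => N; elim: N => [|N IH].
  by rewrite leqn0 => /eqP->.
rewrite leq_eqVlt => /orP[/eqP->//|]; rewrite ltnS => nN; rewrite big_ord_recr /=.
have [G ->] : exists G, Omega_factor b t N = 1 + G * 'X^(b ^ N).
  rewrite /Omega_factor; elim/big_rec: _ => [|l x _ [G ->]].
    by exists 0; rewrite mul0r addr0.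
  have [H ->] : exists H, \sum_(i < lam l) (zvar i ^+ (t l i ^ N)%N) *: 'X^(i.+1 * b ^ N)
      = H * 'X^(b ^ N) :> {poly zpoly lam}.
    elim/big_rec: _ => [|i y _ [H ->]]; first by exists 0; rewrite mul0r.
    exists (zvar i ^+ (t l i ^ N)%N *: 'X^(i * b ^ N) + H).
    by rewrite mulSn addnC exprD mulrDl scalerAl.
  exists (G + H + H * 'X^(b ^ N) * G).
  by rewrite !(mulrDl, mulrDr, mul1r, mulr1) !mulrA !addrA.
rewrite mulrDr mulr1 coefD IH// mulrA coefMXn.
by rewrite (leq_ltn_trans nN) ?addr0// ltn_expl.
Qed.

Lemma Omega_unique (b rho : nat) (lam : 'I_rho -> nat)
    (t : forall l : 'I_rho, 'I_(lam l) -> nat) (Om1 Om2 : nat -> zpoly lam) :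
  is_Omega b t Om1 -> is_Omega b t Om2 -> Om1 =1 Om2.
Proof.
move=> H1 H2 n; have [N1 {}H1] := H1 n; have [N2 {}H2] := H2 n.
by rewrite -(H1 (maxn N1 N2)) ?leq_maxl// H2 ?leq_maxr.
Qed.

(* Main.v *)
(* Expanding the product of the first N factors (N >= n) picks one digit
   m <= lam l for each pair (j, l), that is, the multiplicity of the part b ^ j
   in color l; the coefficient of q ^ n keeps the choices with
   \sum m * b ^ j = n, which are exactly the restricted partitions of n, since
   only parts b ^ j with j < n can occur. A digit m = i.+1 at (j, l) contributes
   z_(l, i) ^ (t_(l, i) ^ j), so the exponent of z_(l, i) is the sum of the
   t_(l, i) ^ j over the j such that b ^ j has multiplicity i.+1 in color l. *)

Require Import Defs.
From mathcomp Require Import all_boot all_order all_algebra finmap multiset.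
From mathcomp Require Import boolp classical_sets functions cardinality.
From mathcomp Require Import mpoly.

Local Open Scope ring_scope.

Import GRing.Theory.

Lemma mset_bigD (K : choiceType) (I : Type) (s : seq I) (Q : pred I)
    (F : I -> {mset K}%mset) (y : K) :
  (\big[@msetD K/mset0]_(x <- s | Q x) F x) y = (\sum_(x <- s | Q x) F x y)%N.
Proof.
apply: (big_morph (fun A : {mset K}%mset => A y)) => [A B|]; last exact: mset0E.
by rewrite msetE2.
Qed.

(** The enumeration of a sum of multisets is a permutation of the concatenated enumerations, hence
    the commutative [op]. *)
Lemma big_msetD (K : choiceType) (R : Type) (idx : R) (op : Monoid.com_law idx)
    (F : K -> R) (A B : {mset K}%mset) :
  \big[op/idx]_(x <- msetD A B) F x =
  op (\big[op/idx]_(x <- A) F x) (\big[op/idx]_(x <- B) F x).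
Proof.
rewrite -big_cat; apply: perm_big; apply/allP => x _.
by rewrite /= count_cat !count_mem_mset msetE2.
Qed.

Lemma msetn_bigD_inj (K : choiceType) (I : finType) (e : I -> K) (f : I -> nat)
    (y : I) :
  injective e -> (\big[@msetD K/mset0]_x msetn (f x) (e x)) (e y) = f y.
Proof.
move=> e_inj; rewrite mset_bigD (bigD1 y) //= big1 ?addn0 ?msetnxx // => x xy.
by rewrite msetnE (inj_eq e_inj) eq_sym (negPf xy).
Qed.

(** Both multiplicities vanish off the image of [e]; on it, injectivity leaves one term. This
    rebuilds a partition from its digits. *)
Lemma mset_bigD_codom (K : choiceType) (I : finType) (e : I -> K) (A : {mset K}%mset) :
  injective e -> {subset A <= codom e} ->
  \big[@msetD K/mset0]_x msetn (A (e x)) (e x) = A.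
Proof.
move=> e_inj sAe; apply/msetP => y; have [/codomP[x ->]|ye] := boolP (y \in codom e).
  exact: (@msetn_bigD_inj _ _ _ (fun x => A (e x))).
have /mset_eq0P -> : y \notin A by apply: contra ye; apply: sAe.
rewrite mset_bigD big1 // => x _; rewrite msetnE; case: eqP => // yx.
by rewrite yx codom_f in ye.
Qed.

Section Partitions.

Context {b rho : nat} {lam : 'I_rho -> nat} {n : nat} (b_gt1 : (1 < b)%N).

Definition part {N : nat} (x : 'I_N * 'I_rho) : nat * 'I_rho := ((b ^ x.1)%N, x.2).

Lemma part_inj N : injective (@part N).
Proof.
by move=> [j l] [k m] [/(expnI b_gt1)/val_inj-> ->].
Qed.

(** These are the exponents tau. The cutoff at [n] loses nothing for a partition of [n], by
    [restricted_exponent_lt], and filtering [iota] keeps them strictly increasing. *)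
Definition exponent_seq (P : {mset nat * 'I_rho}%mset) {l : 'I_rho} (i : 'I_(lam l)) :=
  [seq j <- iota 0 n | P ((b ^ j)%N, l) == i.+1].

(** A part [b ^ j] that occurs is at most the total, so j < b ^ j <= n. *)
Lemma restricted_exponent_lt P j l :
  is_restricted_partition b lam n P -> (0 < P ((b ^ j)%N, l))%N -> (j < n)%N.
Proof.
move=> [_ Psum _] Ppos; apply: leq_trans (ltn_expl j b_gt1) _.
rewrite -Psum sum_mset (big_fsetD1 ((b ^ j)%N, l)) /=.
  by rewrite (leq_trans _ (leq_addr _ _)) // leq_pmull.
by rewrite multiset.msuppE in_mset.
Qed.

Lemma restricted_mset_digits P N :
  is_restricted_partition b lam n P -> (n <= N)%N ->
  \big[@msetD _/mset0]_x msetn (P (part x)) (@part N x) = P.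
Proof.
move=> Pn nN; apply: mset_bigD_codom; first exact: part_inj.
move=> [a l] xP; have [Ppow _ _] := Pn; have [j /= aj] := Ppow _ xP; subst a.
have jN : (j < N)%N.
  by apply: leq_trans nN; apply: (@restricted_exponent_lt P j l); rewrite // -in_mset.
by apply/codomP; exists (Ordinal jN, l).
Qed.

Lemma sum_mset_digits N (f : 'I_N * 'I_rho -> nat) :
  (\sum_(y <- (\big[@msetD _/mset0]_x msetn (f x) (part x) : {mset _}%mset)) y.1 =
   \sum_x f x * b ^ x.1)%N.
Proof.
rewrite (big_morph (fun A : {mset nat * 'I_rho}%mset => \sum_(y <- A) y.1)%N
  (big_msetD _ _ 0%N addn _) (big_mset0 _ _ _)).
by apply: eq_bigr => x _; rewrite enum_msetn big_nseq iter_addn_0 mulnC.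
Qed.

Lemma restricted_sum_digits P N :
  is_restricted_partition b lam n P -> (n <= N)%N ->
  (\sum_(x : 'I_N * 'I_rho) P (part x) * b ^ x.1)%N = n.
Proof.
by move=> Pn nN; rewrite -sum_mset_digits restricted_mset_digits //; case: Pn.
Qed.

Lemma mset_digits_restricted N (f : 'I_N * 'I_rho -> nat) :
  (forall x, f x <= lam x.2)%N -> (\sum_x f x * b ^ x.1)%N = n ->
  is_restricted_partition b lam n (\big[@msetD _/mset0]_x msetn (f x) (part x)).
Proof.
move=> f_le f_sum; split; last 1 first.
- move=> j l; case: (ltnP j N) => jN.
    by rewrite (msetn_bigD_inj _ _ _ _ (Ordinal jN, l) (@part_inj N)) f_le.
  (* For j >= N no position carries the part [b ^ j], as powers of [b] are distinct; its
     multiplicity is 0. *)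
  rewrite mset_bigD big1 // => -[k m] _; rewrite msetnE.
  case: eqP => // -[/(expnI b_gt1) jk _].
  by rewrite jk leqNgt ltn_ord in jN.
- move=> y; rewrite in_mset mset_bigD lt0n sum_nat_eq0 negb_forall.
  case/existsP => x /=; rewrite msetnE; case: (y =P part x) => [->|//] _.
  by exists x.1.
- by rewrite sum_mset_digits.
Qed.

(** Both sides run over the nonzero digits, first grouped by (l, i), then by position. The law is
    kept abstract to serve both [msetD] (partitions) and multiplication (monomials). *)
Lemma big_exponent_seq (R : Type) (idx : R) (op : Monoid.com_law idx) N P
    (G : forall l : 'I_rho, 'I_(lam l) -> nat -> R) :
  is_restricted_partition b lam n P -> (n <= N)%N ->
  \big[op/idx]_(l < rho) \big[op/idx]_(i < lam l)
    \big[op/idx]_(k <- exponent_seq P i) G l i k =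
  \big[op/idx]_(x : 'I_N * 'I_rho)
    \big[op/idx]_(i < lam x.2 | P (part x) == i.+1) G x.2 i x.1.
Proof.
move=> Pn nN; rewrite -(pair_bigA _ (fun (j : 'I_N) l =>
  \big[op/idx]_(i < lam l | P ((b ^ j)%N, l) == i.+1) G l i j)) /= exchange_big /=.
apply: eq_bigr => l _; rewrite [RHS](exchange_big_dep xpredT) //=.
apply: eq_bigr => i _.
rewrite big_filter -[iota 0 n](congr1 (iota 0) (subn0 n)) (big_nat_widen _ _ N) //.
rewrite big_mkord; apply: eq_bigl => j /=.
(* Widening the range from [n] to [N] leaves the side condition j < n, which a nonzero digit
   implies. *)
by apply/andb_idr => /eqP Pj; apply: (@restricted_exponent_lt P j l); rewrite // Pj.
Qed.

Lemma partition_of_exponent_seq P :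
  is_restricted_partition b lam n P ->
  partition_of_exponents b (@exponent_seq P) = P.
Proof.
move=> Pn; rewrite /partition_of_exponents.
rewrite (big_exponent_seq _ _ _ n) // -[RHS](@restricted_mset_digits P n) //.
apply: eq_bigr => x _; have [_ _ /(_ x.1 x.2)] := Pn; rewrite -/(part x).
(* Digit 0 selects no [i]; digit [m.+1] selects exactly the 0-based index [m], valid by [le_m]. *)
case: (P (part x)) => [|m] le_m.
  by rewrite msetn0 big_pred0.
by rewrite (big_pred1 (Ordinal le_m)) // => i; rewrite eqSS eq_sym.
Qed.

(** A product with at most one factor: digit 0 gets weight 1, the constant term of the factor,
    without a case distinction. *)
Definition digit_weight (t : forall l : 'I_rho, 'I_(lam l) -> nat) (j : nat)
    (l : 'I_rho) (m : nat) : zpoly lam :=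
  \prod_(i < lam l | m == i.+1) zvar i ^+ (t l i ^ j)%N.

(** A common bound [M] gives the digits of all colors one type, so that the product of sums
    distributes over plain finite functions. *)
Lemma Omega_factor_digits t j M : (forall l, lam l <= M)%N ->
  Omega_factor b t j =
  \prod_(l < rho) \sum_(m < M.+1 | (m <= lam l)%N)
     digit_weight t j l m *: 'X^(m * b ^ j).
Proof.
move=> leM; apply: eq_bigr => l _; rewrite (big_ord_narrow_leq (leM l)).
rewrite big_ord_recl /= /digit_weight [X in _ = X *: _ + _]big_pred0 // mul0n
  expr0 scale1r.
congr (_ + _); apply: eq_bigr => i _; rewrite (big_pred1 i) //.
Qed.

Lemma coef_Omega_digits t N M : (forall l, lam l <= M)%N ->
  (\prod_(j < N) Omega_factor b t j)`_n =
  \sum_(f : {ffun 'I_N * 'I_rho -> 'I_M.+1} |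
        [forall x : 'I_N * 'I_rho, (f x <= lam x.2)%N] &&
        ((\sum_(x : 'I_N * 'I_rho) f x * b ^ x.1)%N == n))
     \prod_(x : 'I_N * 'I_rho) digit_weight t x.1 x.2 (f x).
Proof.
move=> leM; under eq_bigr do rewrite (Omega_factor_digits t _ M) //.
rewrite pair_bigA /= bigA_distr_big_dep /= coef_sum [RHS]big_mkcondr /=.
apply: eq_big => f; first by apply/familyP/forallP.
(* Each choice of digits yields a single monomial in q, which survives exactly when its degree is
   [n]. *)
move=> _; rewrite scaler_prod -expr_sum coefZ coefXn eq_sym.
by case: eqP => _; rewrite ?mulr1 ?mulr0.
Qed.

Lemma Omega_restricted t (Omega : nat -> zpoly lam) : is_Omega b t Omega ->
  Omega n = \sum_(P <- fset_set (restricted_partitions b lam n))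
    \prod_(l < rho) \prod_(i < lam l)
      zvar i ^+ (\sum_(k <- exponent_seq P i) t l i ^ k)%N.
Proof.
(* [N] is large enough both for the coefficient to be stable and for every exponent j < n to have a
   position. *)
move=> /(_ n)[N0 OmegaN]; pose N := maxn N0 n; pose M := (\max_l lam l)%N.
have nN : (n <= N)%N by rewrite leq_maxr.
have leM l : (lam l <= M)%N by apply: leq_bigmax.
(* [inord] is faithful only up to [M]; [digitsE] checks this for restricted partitions. *)
pose digits (P : {mset nat * 'I_rho}%mset) : {ffun 'I_N * 'I_rho -> 'I_M.+1} :=
  [ffun x => inord (P (part x))].
set S := fset_set _.
have SP P : reflect (is_restricted_partition b lam n P) (P \in S).
  rewrite in_fset_set; last exact: finite_restricted_partitions.
  by apply: asboolP.
have digitsE P x : is_restricted_partition b lam n P -> digits P x = P (part x) :> nat.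
  by case=> _ _ P_le; rewrite ffunE inordK // ltnS (leq_trans (P_le _ _)).
rewrite -(OmegaN N) ?leq_maxl // (coef_Omega_digits _ _ M) //.
(* Reindexing along [digits]: it is injective since a partition is rebuilt from its digits, and an
   admissible [f] comes from the multiset with multiplicities [f x]. *)
rewrite -big_filter (perm_big [seq digits P | P <- S]) /=; last first.
  apply: uniq_perm.
  - by rewrite filter_uniq // index_enum_uniq.
  - rewrite map_inj_in_uniq ?fset_uniq // => P Q /SP Pn /SP Qn PQ.
    rewrite -(@restricted_mset_digits P N) // -(@restricted_mset_digits Q N) //.
    by apply: eq_bigr => x _; rewrite -!digitsE // PQ.
  move=> f; rewrite mem_filter mem_index_enum andbT; apply/andP/mapP.
    case=> /forallP f_le /eqP f_sum.
    pose P : {mset nat * 'I_rho}%mset :=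
      \big[@msetD _/mset0]_x msetn (f x) (part x).
    exists P; first by apply/SP; apply: (mset_digits_restricted N (fun x => f x)).
    apply/ffunP => x; rewrite ffunE /P.
    rewrite (msetn_bigD_inj _ _ _ (fun x => f x) x (@part_inj N)).
    by rewrite inord_val.
  case=> P /SP Pn ->; split.
    by apply/forallP => x; rewrite digitsE //; have [_ _] := Pn; apply.
  under eq_bigr do rewrite digitsE //.
  by rewrite restricted_sum_digits.
rewrite big_map big_seq [RHS]big_seq; apply: eq_bigr => P /SP Pn.
under [RHS]eq_bigr do under eq_bigr do rewrite expr_sum.
rewrite (big_exponent_seq _ _ _ N _ (fun l i k => zvar i ^+ (t l i ^ k)%N)) //.
by apply: eq_bigr => x _; rewrite digitsE.
Qed.

End Partitions.

Theorem theorem3p2 (b rho : nat) (lam : 'I_rho -> nat)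
  (b_ge2 : (2 <= b)%N) (rho_ge1 : (1 <= rho)%N)
  (lam_ge1 : forall l : 'I_rho, (1 <= lam l)%N)
  (lam_mono : forall l l' : 'I_rho, (l <= l')%N -> (lam l <= lam l')%N)
  (n : nat) (n_ge1 : (1 <= n)%N) :
  exists (p : 'I_(num_partitions b lam n) ->
                forall l : 'I_rho, 'I_(lam l) -> {poly nat})
         (tau : 'I_(num_partitions b lam n) ->
                forall l : 'I_rho, 'I_(lam l) -> seq nat),
  [/\ (forall h l i (k : nat), (p h l i)`_k \in [:: 0%N; 1%N]),
      (forall (t : forall l : 'I_rho, 'I_(lam l) -> nat),
         (forall l i, (1 <= t l i)%N) ->
         forall Omega : nat -> zpoly lam, is_Omega b t Omega ->
         Omega n = \sum_(h < num_partitions b lam n)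
                     \prod_(l < rho) \prod_(i < lam l)
                        zvar i ^+ (p h l i).[t l i]),
      (forall h l i, sorted ltn (tau h l i) /\
                     p h l i = \sum_(k <- tau h l i) 'X^k)
    & set_bij [set: 'I_(num_partitions b lam n)]%classic
              (restricted_partitions b lam n)
              (fun h => partition_of_exponents b (tau h))].
Proof.
pose S := enum_fset (fset_set (restricted_partitions b lam n)).
(* The default [mset0] is never reached, since [num_partitions] is the size of [S]. *)
pose P (h : 'I_(num_partitions b lam n)) := nth mset0 S h.
pose tau h l i := @exponent_seq b rho lam n (P h) l i.
have SP Q : Q \in S <-> is_restricted_partition b lam n Q.
  rewrite [_ \in _]in_fset_set; last exact: finite_restricted_partitions.
  by rewrite inE.
have PS h : is_restricted_partition b lam n (P h).
  by apply/SP/mem_nth/ltn_ord.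
exists (fun h l i => \sum_(k <- tau h l i) 'X^k), tau; split.
- move=> h l i k; rewrite coef_sum; under eq_bigr do rewrite coefXn.
  (* The k-th coefficient counts the occurrences of [k] in [tau h l i], at most one without
     repetitions. *)
  have tau_uniq : uniq (tau h l i) by rewrite filter_uniq ?iota_uniq.
  rewrite -natr_sum natn (_ : \sum_(_ <- _) _ = count_mem k (tau h l i)).
    by rewrite count_uniq_mem //; case: (k \in _).
  rewrite -sum1_count [RHS]big_mkcond /=; apply: eq_bigr => j _.
  by rewrite eq_sym; case: eqP.
- move=> t _ Omega /(Omega_restricted b_ge2) ->.
  rewrite (big_nth mset0) big_mkord; apply: eq_bigr => h _.
  apply: eq_bigr => l _; apply: eq_bigr => i _; congr (_ ^+ _).
  rewrite horner_sum; apply: eq_bigr => k _.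
  by rewrite hornerXn natrXE.
- move=> h l i; split=> //; apply: sorted_filter; first exact: ltn_trans.
  exact: iota_ltn_sorted.
(* The correspondence thus reduces to the duplicate-free enumeration of [S]. *)
- have poeE h : partition_of_exponents b (tau h) = P h.
    exact: partition_of_exponent_seq.
  split=> [h _|h k _ _|Q /= /SP QS].
  + by rewrite poeE; apply: PS.
  + by rewrite !poeE => /eqP; rewrite nth_uniq ?fset_uniq // => /eqP/val_inj.
  + exists (Ordinal (etrans (index_mem Q S) QS)) => //.
    by rewrite poeE /P nth_index.
Qed.
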